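(* Let $T:\mathbb{Z}\curvearrowright (X,\mu)$ be a probability-preserving action on a standard Borel probability space and let $A\subset X$ be measurable with $\mu(A)>0$. Then for every integer $k\geq 1$, \[\liminf_{N\to\infty}\frac{1}{N}\sum_{n=1}^N\mu(A\cap T^{-n}A\cap\cdots\cap T^{-(k-1)n}A) > 0.\]
   Context: A probability-preserving action of $\mathbb{Z}$ is identified with the invertible measure-preserving transformation $T$ of $(X,\mu)$ that generates it; $T^n$ denotes its $n$-th iterate and $T^{-n}A=\{x: T^nx\in A\}$. *)

(* Defs.v *)
From HB Require Import structures.
From mathcomp Require Import all_boot all_order all_algebra.
From mathcomp Require Import all_classical all_reals all_analysis.

Set Implicit Arguments.
Unset Strict Implicit.
Unset Printing Implicit Defensive.

Import Order.TTheory GRing.Theory Num.Theory.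

Local Open Scope classical_set_scope.
Local Open Scope ring_scope.

(* The library's [completeType] is pointed, while [metricType] is not, so
   completeness is spelled out. *)
Definition polish (R : realType) (M : metricType R) : Prop :=
  (forall F : set_system M, ProperFilter F -> cauchy F ->
     exists l : M, F --> l) /\
  (exists2 D : set M, countable D & dense D).

Definition standard_borel (R : realType) (d : measure_display)
    (X : measurableType d) : Prop :=
  exists (M : metricType R) (f : X -> M),
    [/\ polish M, bijective f &
        forall A : set X, measurable A <-> <<s @open M >> (f @` A)].

Definition measure_preserving (R : realType) (d : measure_display)
    (X : measurableType d) (mu : probability X R) (f : X -> X) : Prop :=
  measurable_fun setT f /\
  forall B : set X, measurable B -> mu (f @^-1` B) = mu B.

Definition pp_Zaction (R : realType) (d : measure_display)
    (X : measurableType d) (mu : probability X R) (T : int -> X -> X) : Prop :=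
  [/\ forall x, T 0 x = x,
      forall m n x, T (m + n) x = T m (T n x) &
      forall n, measure_preserving mu (T n)].

(* [T n] is the [n]-th iterate of the generator [T 1]. *)
Lemma pp_Zaction_iter (R : realType) (d : measure_display)
    (X : measurableType d) (mu : probability X R) (T : int -> X -> X) :
  pp_Zaction mu T -> forall (n : nat) (x : X), T n%:Z x = iter n (T 1) x.
Proof.
by case=> T0 TD _; elim=> [|n IHn] x //=; rewrite -IHn -TD intS.
Qed.

Lemma pp_Zaction_inv (R : realType) (d : measure_display)
    (X : measurableType d) (mu : probability X R) (T : int -> X -> X) :
  pp_Zaction mu T -> forall n : int, cancel (T n) (T (- n)).
Proof. by case=> T0 TD _ n x; rewrite -TD addNr. Qed.

(* Main.v *)
Require Import Defs.
From HB Require Import structures.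
From mathcomp Require Import all_boot all_order all_algebra.
From mathcomp Require Import all_classical all_reals all_analysis.
From mathcomp Require Import measurable_realfun zify lra.

(** The average is bounded below because multiple returns are frequent along
    every dilation.  Fix [m].  A word [w] over [k] letters is read as the time
    [m * (w_1 + ... + w_n)].  Averaged over all words of a fixed length [n], the
    proportion of these times at which a point is in [A] has mean [mu A], so it
    is at least [mu A / 2] on a set of measure at least [mu A / 2].  By the
    density Hales-Jewett theorem, the words at which such a point is in [A]
    contain a combinatorial line, and the times of a line form an arithmetic
    progression of length [k] and step [r * m] with [1 <= r <= n].  Hence the
    measure of the set of points that return to [A] along a progression with
    step [r * m], summed over [r <= n], is bounded below uniformly in [m >= 1]
    ([returns_multiple]).  A step [j <= N] arises from at most [n] pairs
    [(r, m)], so summing over [m <= N / n] proves the theorem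
    ([sum_multiples]).

    The density Hales-Jewett theorem ([density_Hales_Jewett]) is proved by
    induction on the number of letters, in the spirit of the Polymath proof,
    with extremal arguments in place of density increments.  The limit [h] of
    the maximal densities of line-free sets exists, and a nearly extremal set
    has density almost [h] on all sub-cubes of bounded codimension
    ([extremal_mean]).  If [h > 0], the theorem for [k] letters shows that a
    nearly extremal set [A] over [k.+1] letters avoids, in suitable subspaces,
    an intersection of sets [C a], [a < k], with [C a] insensitive to exchanges
    of [a] and the last letter, and that these intersections have density
    bounded below ([DHJ_succ]).  On the other hand [A] has density at most
    about [h] relatively to the complement of such an intersection
    ([complement_limsup_nonpos]): insensitive sets contain subspaces of large
    dimension ([insensitive_subspace]), and this is enough to transfer the
    upper bound [h] from subspaces to insensitive sets ([cut_limsup_nonpos]).  So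
    [A] has density less than [h] in these subspaces, a contradiction. *)

Set Implicit Arguments.
Unset Strict Implicit.
Unset Printing Implicit Defensive.

Import Order.TTheory GRing.Theory Num.Theory.

Local Open Scope classical_set_scope.
Local Open Scope ring_scope.

(** * Averages over finite lists *)

Section Mean.
Context (R : realType).

Definition mean (T : Type) (s : seq T) (f : T -> R) : R :=
  (\sum_(x <- s) f x) / (size s)%:R.

Lemma mean_const (T : Type) (s : seq T) (c : R) :
  (0 < size s)%N -> mean s (fun=> c) = c.
Proof.
move=> s0; rewrite /mean big_const_seq count_predT iter_addr_0 -[c *+ _]mulr_natr mulfK//.
by rewrite pnatr_eq0 -lt0n.
Qed.

Lemma meanD (T : Type) (s : seq T) (f g : T -> R) :
  mean s (fun x => f x + g x) = mean s f + mean s g.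
Proof. by rewrite /mean big_split mulrDl. Qed.

Lemma meanZ (T : Type) (s : seq T) (c : R) (f : T -> R) :
  mean s (fun x => c * f x) = c * mean s f.
Proof. by rewrite /mean -big_distrr mulrA. Qed.

Lemma meanB (T : Type) (s : seq T) (f g : T -> R) :
  mean s (fun x => f x - g x) = mean s f - mean s g.
Proof. by rewrite /mean sumrB mulrBl. Qed.

Lemma mean_sum (T I : Type) (s : seq T) (r : seq I) (f : I -> T -> R) :
  mean s (fun x => \sum_(i <- r) f i x) = \sum_(i <- r) mean s (f i).
Proof. by rewrite /mean exchange_big big_distrl. Qed.

Lemma mean_exchange (T U : Type) (s : seq T) (r : seq U) (f : T -> U -> R) :
  mean s (fun x => mean r (f x)) = mean r (fun y => mean s (f^~ y)).
Proof.
rewrite /mean -!big_distrl/= exchange_big/=.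
by rewrite -!mulrA [X in _ * X]mulrC.
Qed.

Lemma mean_allpairs (T U V : Type) (s : seq T) (r : seq U) (h : T -> U -> V)
    (f : V -> R) :
  mean [seq h x y | x <- s, y <- r] f = mean s (fun x => mean r (fun y => f (h x y))).
Proof.
rewrite /mean/= big_allpairs_dep size_allpairs/= natrM invfM -big_distrl/=.
by rewrite -mulrA [X in _ * X]mulrC.
Qed.

Lemma eq_mean (T : eqType) (s : seq T) (f g : T -> R) :
  {in s, f =1 g} -> mean s f = mean s g.
Proof. by move=> fg; rewrite /mean (eq_big_seq _ fg). Qed.

Lemma ler_mean (T : eqType) (s : seq T) (f g : T -> R) :
  {in s, forall x, f x <= g x} -> mean s f <= mean s g.
Proof.
move=> fg; rewrite /mean ler_wpM2r ?invr_ge0//.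
by rewrite big_seq [leRHS]big_seq; apply: ler_sum => x /fg.
Qed.

Lemma mean_le (T : eqType) (s : seq T) (f : T -> R) (c : R) :
  (0 < size s)%N -> {in s, forall x, f x <= c} -> mean s f <= c.
Proof. by move=> s0 fc; rewrite -(mean_const c s0); exact: ler_mean. Qed.

Lemma mean_ge (T : eqType) (s : seq T) (f : T -> R) (c : R) :
  (0 < size s)%N -> {in s, forall x, c <= f x} -> c <= mean s f.
Proof. by move=> s0 fc; rewrite -[leLHS](mean_const c s0); exact: ler_mean. Qed.

Lemma mean_ex (T : eqType) (s : seq T) (f : T -> R) (c : R) :
  (0 < size s)%N -> c <= mean s f -> exists2 x, x \in s & c <= f x.
Proof.
move=> s0 cf; apply: contrapT => nex.
suff : mean s f < c by rewrite ltNge cf.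
rewrite /mean ltr_pdivrMr ?ltr0n// mulr_natr -[size s]count_predT.
rewrite -iter_addr_0 -big_const_seq big_seq [ltRHS]big_seq.
have lt x : x \in s -> f x < c.
  by move=> xs; rewrite ltNge; apply/negP => cx; apply: nex; exists x.
apply: ltr_sum => //; apply/hasP.
by case: s s0 {cf nex lt} => // a s _; exists a; rewrite mem_head.
Qed.

(** A value far below [h] would have to be compensated by values above
    [h + e]. *)
Lemma mean_near_max (T : eqType) (s : seq T) (f : T -> R) (h e : R) :
  (0 < size s)%N -> h - e <= mean s f -> {in s, forall x, f x <= h + e} ->
  {in s, forall x, h - 2 * (size s)%:R * e <= f x}.
Proof.
move=> s0 hf fh x xs.
have N0 : 0 < (size s)%:R :> R by rewrite ltr0n.
have e0 : 0 <= e.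
  have := mean_le s0 fh; lra.
have : \sum_(y <- s) (h + e - f y) <= 2 * (size s)%:R * e.
  rewrite sumrB big_const_seq count_predT iter_addr_0 -[_ *+ size s]mulr_natr.
  move: hf; rewrite /mean ler_pdivlMr//; nra.
rewrite (perm_big _ (perm_to_rem xs))/= big_cons.
have : 0 <= \sum_(y <- rem x s) (h + e - f y).
  rewrite big_seq; apply: sumr_ge0 => y /mem_rem ys; have := fh y ys; lra.
lra.
Qed.

(** If the average of [f] is at least [e], the points where [f >= e / 2]
    have density at least [e / 2]; one of the finitely many labels that
    those points carry is therefore frequent.  The successor in the bound keeps
    it positive for every list [r]. *)
Lemma mean_pigeonhole (T : eqType) (I : eqType) (s : seq T) (r : seq I)
    (f : T -> R) (e : R) (P : I -> T -> bool) :
  (0 < size s)%N -> 0 < e -> e <= mean s f -> {in s, forall x, f x <= 1} ->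
  {in s, forall x, e / 2 <= f x -> has (P^~ x) r} ->
  exists2 i, i \in r & e / 2 / (size r).+1%:R <= mean s (fun x => (P i x)%:R).
Proof.
move=> s0 e0 ef f1 fP.
have le : {in s, forall x, f x <= e / 2 + \sum_(i <- r) (P i x)%:R}.
  move=> x xs; case: (lerP (e / 2) (f x)) => [/(fP x xs)/hasP[i ir Pi]|lt].
    have -> : \sum_(i <- r) (P i x)%:R = 1 + \sum_(i <- rem i r) (P i x)%:R :> R.
      by rewrite (perm_big _ (perm_to_rem ir))/= big_cons Pi.
    have : 0 <= \sum_(i <- rem i r) (P i x)%:R :> R by apply: sumr_ge0.
    by have := f1 x xs; lra.
  have : 0 <= \sum_(i <- r) (P i x)%:R :> R by apply: sumr_ge0.
  lra.
have := le_trans ef (ler_mean le).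
rewrite meanD mean_const// mean_sum => le2.
have r0 : (0 < size r)%N.
  case: r {fP le} le2 => //; rewrite big_nil; lra.
have : e / 2 / (size r).+1%:R <= mean r (fun i => mean s (fun x => (P i x)%:R)).
  rewrite (@le_trans _ _ (e / 2 / (size r)%:R))//.
    by rewrite ler_pM2l ?divr_gt0// lef_pV2 ?posrE ?ltr0n// ler_nat.
  rewrite ler_pM2r ?invr_gt0 ?ltr0n//.
  by rewrite -[X in _ <= X]/(\sum_(i <- r) mean s (fun x => (P i x)%:R)); lra.
exact: mean_ex.
Qed.

End Mean.

(** * Words *)

(** The list of all words of length [n] over the alphabet [s].  Letters have an
    arbitrary type: words of words, words of wildcards and words of coordinate
    patterns are needed too. *)
Fixpoint words (T : Type) (s : seq T) (n : nat) : seq (seq T) :=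
  if n is m.+1 then [seq a :: w | a <- s, w <- words s m] else [:: [::]].

Lemma size_words_gt0 (T : Type) (s : seq T) n :
  (0 < size s)%N -> (0 < size (words s n))%N.
Proof. by move=> s0; elim: n => //= n IHn; rewrite size_allpairs muln_gt0 s0. Qed.

Lemma mem_words (T : eqType) (s : seq T) n (w : seq T) :
  (w \in words s n) = (size w == n) && all (mem s) w.
Proof.
elim: n w => [|n IHn] w /=; first by rewrite inE; case: w.
apply/allpairsP/idP => [[[a v]] /= [aS]|].
  by rewrite IHn => /andP[/eqP sv vS] ->; rewrite /= sv eqxx aS.
by case: w => // a w /=; rewrite eqSS => /and3P[sw aS wS]; exists (a, w);
  split => //; rewrite IHn sw.
Qed.

Lemma mean_words_cat (R : realType) (T : Type) (s : seq T) m n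
    (f : seq T -> R) :
  mean (words s (m + n)) f =
  mean (words s m) (fun u => mean (words s n) (fun v => f (u ++ v))).
Proof.
elim: m f => [|m IHm] f; first by rewrite /mean/= big_seq1 divr1.
rewrite addSn /= !mean_allpairs; congr mean; apply/funext => a; exact: IHm.
Qed.

Lemma mean_words_middle (R : realType) (T : Type) (s : seq T) m n
    (f : seq T -> R) :
  mean (words s (m + n.+1)) f =
  mean (words s m) (fun u => mean (words s n) (fun v => mean s (fun x => f (u ++ x :: v)))).
Proof.
rewrite mean_words_cat; congr mean; apply/funext => u.
by rewrite /= mean_allpairs mean_exchange.
Qed.

(** * Combinatorial lines and subspaces *)

Notation cube K n := (words (iota 0 K) n).

(** In a pattern [L], the letter [None] is the wildcard and [plug L a] is the
    point of the combinatorial line of [L] at the letter [a]. *)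
Definition plug (L : seq (option nat)) (a : nat) : seq nat := map (odflt a) L.

Definition lines K n : seq (seq (option nat)) :=
  [seq L <- words (None :: map Some (iota 0 K)) n | None \in L].

Definition line_in k (A : pred (seq nat)) (L : seq (option nat)) : bool :=
  all (fun a => A (plug L a)) (iota 0 k).

(** A pattern [s] of a combinatorial subspace has fixed letters [inl c] and
    coordinates [inr j], and [embed s] is its parametrization. *)
Definition embed (s : seq (nat + nat)) (t : seq nat) : seq nat :=
  map (fun x => match x with inl c => c | inr j => nth 0%N t j end) s.

Definition subspaces K q n : seq (seq (nat + nat)) :=
  [seq s <- words (map inl (iota 0 K) ++ map inr (iota 0 q)) n
     | all (fun j => inr j \in s) (iota 0 q)].

Lemma size_cube_gt0 K n : (0 < K)%N -> (0 < size (cube K n))%N.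
Proof. by move=> K0; apply: size_words_gt0; rewrite size_iota. Qed.

Lemma mem_cube K n w : (w \in cube K n) = (size w == n) && all (fun a => a < K)%N w.
Proof. by rewrite mem_words; congr andb; apply: eq_all => a /=; rewrite mem_iota. Qed.

Lemma mem_lines K n L : (L \in lines K n) =
  [&& None \in L, size L == n & all (fun x => if x is Some c then (c < K)%N else true) L].
Proof.
rewrite mem_filter mem_words; congr [&& _, _ & _]; apply: eq_all => -[c|]//=.
by rewrite inE/= mem_map ?mem_iota// => ? ? [].
Qed.

Lemma mem_subspaces K q n s : (s \in subspaces K q n) =
  [&& all (fun j => inr j \in s) (iota 0 q), size s == n &
      all (fun x => match x with inl c => c < K | inr j => j < q end)%N s].
Proof.
rewrite mem_filter mem_words; congr [&& _, _ & _]; apply: eq_all => -[c|j]/=.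
  rewrite mem_cat mem_map ?mem_iota; last by move=> ? ? [].
  by rewrite orbC; case: mapP => // -[].
rewrite mem_cat orbC mem_map ?mem_iota; last by move=> ? ? [].
by rewrite orbC; case: mapP => // -[].
Qed.

Lemma plug_cube K n L a : L \in lines K n -> (a < K)%N -> plug L a \in cube K n.
Proof.
rewrite mem_lines mem_cube => /and3P[_ /eqP <- LK] aK; rewrite size_map eqxx/=.
by rewrite all_map; apply: sub_all LK => -[c|].
Qed.

Lemma embed_cube K q n s t :
  s \in subspaces K q n -> t \in cube K q -> embed s t \in cube K n.
Proof.
rewrite mem_subspaces !mem_cube => /and3P[_ /eqP <- sK] /andP[/eqP tq tK].
rewrite size_map eqxx/= all_map; apply: sub_all sK => -[c|j]//=; rewrite -tq => jt.
by apply: (allP tK); rewrite mem_nth.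
Qed.

(** A combinatorial subspace maps combinatorial lines to combinatorial lines:
    the wildcard of [L] sits at some coordinate, and that coordinate occurs in
    the pattern [s]. *)
Lemma embed_line K q n s L : s \in subspaces K q n -> L \in lines K q ->
  exists2 L', L' \in lines K n & forall a, embed s (plug L a) = plug L' a.
Proof.
rewrite mem_subspaces mem_lines => /and3P[sq /eqP sn sK] /and3P[NL /eqP Lq LK].
exists (map (fun x => match x with inl c => Some c | inr j => nth None L j end) s).
  rewrite mem_lines size_map sn eqxx/=; apply/andP; split.
    apply/mapP; exists (inr (index None L)); last by rewrite nth_index.
    by apply: (allP sq); rewrite mem_iota/= -Lq index_mem.
  rewrite all_map; apply: sub_all sK => -[c|j]//=; rewrite -Lq => jL.
  by apply: (allP LK); rewrite mem_nth.
move=> a; rewrite /plug /embed -map_comp; apply/eq_in_map => -[c|j] //= /(allP sK) jq.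
by rewrite (nth_map None) ?Lq.
Qed.

Definition slice (u : seq nat) n (v : seq nat) : seq (nat + nat) :=
  map inl u ++ map inr (iota 0 n) ++ map inl v.

Lemma slice_subspaces K u n v m :
  all (fun a => a < K)%N u -> all (fun a => a < K)%N v ->
  m = (size u + n + size v)%N -> slice u n v \in subspaces K n m.
Proof.
move=> uK vK ->; rewrite mem_subspaces !size_cat !size_map size_iota addnA eqxx/=.
rewrite !all_cat !all_map uK vK /= andbT; apply/andP; split; apply/allP => j jn/=.
  by rewrite !mem_cat map_f ?orbT.
by move: jn; rewrite mem_iota.
Qed.

Lemma embed_slice u n v t : size t = n -> embed (slice u n v) t = u ++ t ++ v.
Proof.
move=> <-; rewrite /embed /slice !map_cat -!map_comp; set e := (X in X \o inl).
have idl w : map (e \o inl) w = w by elim: w => //= a w ->.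
rewrite !idl; congr (_ ++ (_ ++ _)).
by rewrite -[RHS]take_size -(map_nth_iota0 0%N).
Qed.

(** * Extremal functions of a hereditary class *)

Section Extremal.
Context (R : realType).

(** Classes [F] of functions on cubes, indexed by the dimension, play the role
    of the family of line-free sets in the extremal arguments. *)
Definition hereditary K (F : nat -> (seq nat -> R) -> Prop) :=
  forall n q f s, F n f -> s \in subspaces K q n -> F q (fun t => f (embed s t)).

(** The constant [h] is the limit, as the dimension grows, of the supremum of
    the averages of the members of the class.  Since averages over large
    sub-cubes never beat [h] by much, a nearly extremal function has average
    nearly [h] on every sub-cube of bounded codimension.  Passing to an extremal
    function in this way replaces a density increment iteration. *)
Lemma extremal_mean K (F : nat -> (seq nat -> R) -> Prop) (B : R) :
  (0 < K)%N -> hereditary K F ->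
  (forall n f, F n f -> `|mean (cube K n) f| <= B) ->
  (forall n, exists f, F n f) ->
  exists h : R,
    (forall e, 0 < e -> exists n0, forall n, (n0 <= n)%N ->
       forall f, F n f -> mean (cube K n) f <= h + e) /\
    (forall M e, 0 < e -> exists n0, forall n, (n0 <= n)%N ->
       exists2 f, F (M + n)%N f &
         {in cube K M, forall u, h - e <= mean (cube K n) (fun w => f (u ++ w))}).
Proof.
move=> K0 Fher FB Fne.
pose S := [set c : R | exists n0, forall n, (n0 <= n)%N ->
  forall f, F n f -> mean (cube K n) f <= c]%classic.
have Fpre m n f u : F (m + n)%N f -> u \in cube K m ->
    exists2 g, F n g & mean (cube K n) g = mean (cube K n) (fun w => f (u ++ w)).
  move=> Ff; rewrite mem_cube => /andP[/eqP um uK].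
  exists (fun t => f (embed (slice u n [::]) t)).
    by apply: Fher Ff _; apply: slice_subspaces; rewrite ?um ?addn0.
  apply: eq_mean => w; rewrite mem_cube => /andP[/eqP wn _].
  by rewrite embed_slice// cats0.
have SB : S B by exists 0%N => n _ f /FB; rewrite ler_norml => /andP[].
have Slb : lbound S (- B).
  move=> c [n0 Sc]; have [f Ff] := Fne n0.
  have := Sc _ (leqnn _) _ Ff; have := FB _ _ Ff; rewrite ler_norml; lra.
have Sinf : has_inf S by split; [exists B|exists (- B)].
pose h := inf S; exists h.
have up e : 0 < e -> exists n0, forall n, (n0 <= n)%N ->
    forall f, F n f -> mean (cube K n) f <= h + e.
  move=> e0; have [c [n0 Sc] ch] := inf_adherent e0 Sinf.
  by exists n0 => n nn f Ff; rewrite (le_trans (Sc _ nn _ Ff))// ltW.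
have low n e : 0 < e -> exists2 f, F n f & h - e <= mean (cube K n) f.
  move=> e0; apply: contrapT => nex.
  suff : S (h - e) by move=> /(ge_inf (proj2 Sinf)); rewrite -/h; lra.
  exists n => m nm f Ff; rewrite -(subnK nm) mean_words_cat.
  apply: mean_le; first exact: size_cube_gt0.
  move=> u um; rewrite -(subnK nm) in Ff; have [g Fg <-] := Fpre _ _ _ _ Ff um.
  by rewrite leNgt; apply/negP => /ltW gh; apply: nex; exists g.
split=> // M e e0.
have W0 : 0 < (size (cube K M))%:R :> R by rewrite ltr0n size_cube_gt0.
pose e1 := e / (2 * (size (cube K M))%:R).
have e10 : 0 < e1 by rewrite divr_gt0// mulr_gt0.
have [n0 nP] := up _ e10; exists n0 => n nn.
have [f Ff fh] := low (M + n)%N _ e10; exists f => // u uM.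
have := @mean_near_max R _ (cube K M) (fun u => mean (cube K n) (fun w => f (u ++ w))) h e1.
rewrite -mean_words_cat => /(_ (size_cube_gt0 _ K0) fh) H.
have -> : e = 2 * (size (cube K M))%:R * e1.
  by rewrite /e1 mulrCA divff ?mulr1// gt_eqF// mulr_gt0.
by apply: H => // v vM; have [g Fg <-] := Fpre _ _ _ _ Ff vM; exact: nP.
Qed.

End Extremal.

(** * Line-free sets *)

Section LineFree.
Context (R : realType).

(** The density Hales-Jewett property for [k] letters.  One dimension [n] is
    enough: in a larger cube, a dense set is dense on some [n]-dimensional
    sub-cube. *)
Definition DHJ k : Prop := forall d : R, 0 < d -> exists n, forall A : pred (seq nat),
  d <= mean (cube k n) (fun w => (A w)%:R) -> has (line_in k A) (lines k n).

Definition line_free k K n (f : seq nat -> R) : Prop :=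
  exists2 A : pred (seq nat), f = (fun w => (A w)%:R) &
    ~~ has (line_in k A) (lines K n).

Lemma line_free_hereditary k K : hereditary K (line_free k K).
Proof.
move=> n q f s [A -> Afree] sq; exists (fun t => A (embed s t)) => //.
apply: contra Afree => /hasP[L Lq AL]; have [L' L'n sL] := embed_line sq Lq.
by apply/hasP; exists L' => //; apply: sub_all AL => a; rewrite -sL.
Qed.

Lemma divr2_gt0 (x : R) : 0 < x -> 0 < x / 2. Proof. lra. Qed.

Lemma indic_le1 (b : bool) : b%:R <= 1 :> R. Proof. by case: b. Qed.

Lemma line_free_bounded k K n f : (0 < K)%N -> line_free k K n f ->
  `|mean (cube K n) f| <= 1.
Proof.
move=> K0 [A -> _]; rewrite ler_norml; apply/andP; split.
  apply: mean_ge => [|w _]; first exact: size_cube_gt0.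
  by apply: le_trans (ler0n _ _); rewrite oppr_le0.
by apply: mean_le => [|w _]; [exact: size_cube_gt0|exact: indic_le1].
Qed.

Lemma line_free_exists k K n : (0 < k)%N -> exists f, line_free k K n f.
Proof.
move=> k0; exists (fun w => (pred0 w)%:R), pred0 => //.
by apply/hasPn => L _; case: k k0.
Qed.

Lemma mem_lines_cat K m n L w : L \in lines K m -> w \in cube K n ->
  L ++ map Some w \in lines K (m + n).
Proof.
rewrite !mem_lines mem_cube => /and3P[NL /eqP <- LK] /andP[/eqP <- wK].
by rewrite mem_cat NL size_cat size_map eqxx all_cat LK all_map.
Qed.

Lemma plug_cat L L' a : plug (L ++ L') a = plug L a ++ plug L' a.
Proof. exact: map_cat. Qed.

Lemma plug_Some w a : plug (map Some w) a = w.
Proof. by rewrite /plug -map_comp map_id. Qed.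

Lemma cube_sub k K n w : (k <= K)%N -> w \in cube k n -> w \in cube K n.
Proof.
move=> kK; rewrite !mem_cube => /andP[-> wk]; apply: sub_all wk => a ak.
exact: leq_trans kK.
Qed.

(** The words over the first [k] letters are a negligible part of the cube over
    [K] letters, so density says nothing about them directly.  But in an almost
    extremal line-free set every fibre over a word of length [M], hence every
    fibre over a word in the first [k] letters, has almost the extremal
    density. *)
Lemma DHJ_extend k K (d : R) : DHJ k -> (0 < k <= K)%N -> 0 < d ->
  exists n, forall A : pred (seq nat),
    d <= mean (cube K n) (fun w => (A w)%:R) -> has (line_in k A) (lines K n).
Proof.
move=> dhj /andP[k0 kK] d0; have K0 := leq_trans k0 kK.
have [h [hup hlow]] := extremal_mean K0 (@line_free_hereditary k K)
  (fun n f => @line_free_bounded k K n f K0) (fun n => line_free_exists K n k0).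
have [h0|h0] := lerP h 0.
  have [n0 nP] := hup _ (divr2_gt0 d0); exists n0 => A dA.
  rewrite -[has _ _]negbK; apply/negP => Afree.
  by have := nP _ (leqnn _) _ (ex_intro2 _ _ A erefl Afree); lra.
have [M MP] := dhj _ (divr2_gt0 h0).
have [n0 nP] := hlow M _ (divr2_gt0 h0).
have [_ [A -> Afree] Au] := nP _ (leqnn _).
have : h / 2 <= mean (cube k M) (fun u => mean (cube K n0) (fun w => (A (u ++ w))%:R)).
  apply: mean_ge; first exact: size_cube_gt0.
  by move=> u /(cube_sub kK) /Au; lra.
rewrite mean_exchange => /mean_ex -/(_ (size_cube_gt0 _ K0))[w wn].
move=> /(MP (fun u => A (u ++ w)))/hasP[L LM AL].
suff : has (line_in k A) (lines K (M + n0)) by rewrite (negbTE Afree).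
apply/hasP; exists (L ++ map Some w).
  apply: mem_lines_cat => //; move: LM; rewrite !mem_lines => /and3P[-> -> LM]/=.
  by apply: sub_all LM => -[c|]//= ck; exact: leq_trans kK.
by apply: sub_all AL => a; rewrite plug_cat plug_Some.
Qed.

End LineFree.

(** * Insensitive sets *)

Section Insensitive.
Context (R : realType).

Definition flip (b a x : nat) : nat := if x == b then a else x.

(** Invariance under replacing all occurrences of [b] by [a] amounts to
    invariance under exchanging these letters at arbitrary positions. *)
Definition insensitive (b a : nat) (D : pred (seq nat)) : Prop :=
  forall w, D w = D (map (flip b a) w).

Lemma flip_idem b a : flip b a \o flip b a =1 flip b a.
Proof. by move=> x; rewrite /= /flip; case: (eqVneq x b) => [_|/negbTE ->]//; case: eqP. Qed.

Lemma insensitive_eq b a D u v : insensitive b a D ->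
  map (flip b a) u = map (flip b a) v -> D u = D v.
Proof. by move=> Di uv; rewrite Di uv -Di. Qed.

Lemma flip_embed b a s t : (0 < b)%N ->
  map (flip b a) (embed s (map (flip b a) t)) = map (flip b a) (embed s t).
Proof.
move=> b0; rewrite /embed -!map_comp; apply: eq_map => -[c|j] //=.
have [jt|tj] := ltnP j (size t); first by rewrite (nth_map 0%N)//; exact: flip_idem.
by rewrite !nth_default ?size_map.
Qed.

Lemma insensitive_embed b a s D : (0 < b)%N ->
  insensitive b a D -> insensitive b a (fun t => D (embed s t)).
Proof. by move=> b0 Di t; apply: insensitive_eq Di _; rewrite flip_embed. Qed.

Lemma insensitive_cat b a u v D :
  insensitive b a D -> insensitive b a (fun w => D (u ++ w ++ v)).
Proof.
move=> Di w; apply: insensitive_eq Di _.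
by rewrite !map_cat -map_comp (eq_map (flip_idem b a)).
Qed.

Lemma flip_plug b a L : map (flip b a) (plug L b) = map (flip b a) (plug L a).
Proof.
rewrite /plug -!map_comp; apply: eq_map => -[c|]//=.
by rewrite /flip eqxx; case: eqP.
Qed.

(** If [D] cannot distinguish [k] from [a < k], then a line whose points at the
    letters below [k] lie in [D] has its last point, at [k], in [D] as well.
    One such line is common to many fibres, and the set of these fibres is
    insensitive again: iterating gives a subspace, one coordinate at a time. *)
Lemma insensitive_subspace k a q (e : R) : DHJ R k -> (a < k)%N -> 0 < e ->
  exists M, forall D : pred (seq nat), insensitive k a D ->
    e <= mean (cube k.+1 M) (fun w => (D w)%:R) ->
    has (fun s => all (fun t => D (embed s t)) (cube k.+1 q)) (subspaces k.+1 q M).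
Proof.
move=> dhj ak; have k0 : (0 < k)%N by exact: leq_ltn_trans ak.
have k0K : (0 < k <= k.+1)%N by rewrite k0/=.
elim: q e => [|q IHq] e e0.
  exists 0%N => D _; rewrite /mean/= big_seq1 divr1 /subspaces/= !orbF andbT.
  by case: (D _) => //=; lra.
have [M1 MP1] := DHJ_extend dhj k0K (divr2_gt0 e0).
pose e' := e / 2 / (size (lines k.+1 M1)).+1%:R.
have e'0 : 0 < e' by rewrite !divr_gt0// ltr0n.
have [M2 MP2] := IHq _ e'0.
exists (M1 + M2)%N => D Di; rewrite mean_words_cat mean_exchange => eD.
have [|w _|w _ /MP1|L LM1] := @mean_pigeonhole R _ _ _ (lines k.+1 M1) _ e
  (fun L w => all (fun a => D (plug L a ++ w)) (iota 0 k.+1)) _ e0 eD _ _.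
- exact: size_cube_gt0.
- by apply: mean_le => [|u _]; [exact: size_cube_gt0|exact: indic_le1].
- move=> /hasP[L LM AL]; apply/hasP; exists L => //; apply/allP => c.
  rewrite mem_iota/= add0n ltnS leq_eqVlt => /orP[/eqP ->|ck].
    rewrite (insensitive_eq (v := plug L a ++ w) Di) ?map_cat ?flip_plug//.
    by apply: (allP AL); rewrite mem_iota.
  by apply: (allP AL); rewrite mem_iota.
move=> /MP2 -/(_ _)/hasP[].
  move=> w; apply: eq_all => c.
  by have := insensitive_cat (plug L c) [::] Di w; rewrite !cats0.
move=> s sM2 /allP sD; apply/hasP.
exists (map (fun x => if x is Some c then inl c else inr 0%N) L ++
        map (fun x => match x with inl c => inl c | inr j => inr j.+1 end) s).
  move: LM1 sM2; rewrite mem_lines !mem_subspaces size_cat !size_map.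
  move=> /and3P[NL /eqP -> LK] /and3P[sq /eqP -> sK]; rewrite eqxx/= mem_cat.
  rewrite -andbA; apply/and3P; split.
  - apply/orP; left; apply/mapP; exists None => //.
  - apply/allP => j; rewrite mem_iota => /andP[]; case: j => // j _ jq.
    rewrite mem_cat; apply/orP; right; apply/mapP; exists (inr j) => //.
    by apply: (allP sq); rewrite mem_iota.
  - rewrite all_cat !all_map; apply/andP; split; first by apply: sub_all LK => -[].
    by apply: sub_all sK => -[c|j].
apply/allP => t; rewrite mem_cube => /andP[/eqP]; case: t => // c t [tq] /=/andP[ck tk].
have -> : embed (map (fun x => if x is Some c then inl c else inr 0%N) L ++
   map (fun x => match x with inl c => inl c | inr j => inr j.+1 end) s) (c :: t)
   = plug L c ++ embed s t.
  rewrite /embed map_cat -!map_comp; congr (_ ++ _); apply: eq_map => -[]//=.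
have /sD/allP : t \in cube k.+1 q by rewrite mem_cube tq eqxx.
by apply; rewrite mem_iota.
Qed.

End Insensitive.

(** * Averages on insensitive sets *)

Section CutAverages.
Context (R : realType).
Implicit Type F : nat -> (seq nat -> R) -> Prop.

Definition limsup_nonpos K F := forall e : R, 0 < e -> exists n0, forall n, (n0 <= n)%N ->
  forall f, F n f -> mean (cube K n) f <= e.

Definition bounded_class F := forall n f w, F n f -> `|f w| <= 1.

Definition cut k a F n g := exists f D,
  [/\ F n f, insensitive k a D & g = fun w => f w * (D w)%:R].

Lemma cut_hereditary k a F : (0 < k)%N ->
  hereditary k.+1 F -> hereditary k.+1 (cut k a F).
Proof.
move=> k0 Fher n q g s [f [D [Ff Di ->]]] sq.
exists (fun t => f (embed s t)), (fun t => D (embed s t)).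
by split=> //; [exact: Fher Ff sq|exact: insensitive_embed].
Qed.

Lemma cut_bounded k a F : bounded_class F -> bounded_class (cut k a F).
Proof.
move=> Fb n g w [f [D [Ff _ ->]]].
by case: (D w); rewrite ?mulr1 ?mulr0 ?normr0//; exact: Fb Ff.
Qed.

Lemma cut_exists k a F : (forall n, exists f, F n f) -> forall n, exists f, cut k a F n f.
Proof. by move=> Fne n; have [f Ff] := Fne n; exists (fun w => f w * true%:R), f, xpredT. Qed.

(** Informally, an insensitive set is almost partitioned into subspaces of large
    dimension, and [f] has small average on each of them.  The partition is
    avoided by an extremal argument: take a pair [f], [D] that nearly maximizes
    the average of [(f - kappa) 1_D], and suppose that this maximum is positive.
    Many fibres of [D] contain one and the same subspace, on which [f] has
    average at most [kappa / 2]; discarding this part of [D] leaves insensitive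
    fibres with a substantially larger average of [(f - kappa) 1_D]. *)
Lemma cut_limsup_nonpos k a F : DHJ R k -> (a < k)%N -> hereditary k.+1 F ->
  bounded_class F -> (forall n, exists f, F n f) -> limsup_nonpos k.+1 F ->
  limsup_nonpos k.+1 (cut k a F).
Proof.
move=> dhj ak Fher Fb Fne Fv e e0.
have k0 : (0 < k)%N by exact: leq_ltn_trans ak.
pose kappa := e / 2; have kappa0 : 0 < kappa := divr2_gt0 e0.
pose G n g := exists f D,
  [/\ F n f, insensitive k a D & g = fun w => (f w - kappa) * (D w)%:R].
have Gher : hereditary k.+1 G.
  move=> n q g s [f [D [Ff Di ->]]] sq.
  exists (fun t => f (embed s t)), (fun t => D (embed s t)).
  by split=> //; [exact: Fher Ff sq|exact: insensitive_embed].
have GB n g : G n g -> `|mean (cube k.+1 n) g| <= 1 + kappa.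
  move=> [f [D [Ff _ ->]]]; rewrite ler_norml.
  have fb w : - (1 + kappa) <= (f w - kappa) * (D w)%:R <= 1 + kappa.
    have := Fb _ _ w Ff; rewrite ler_norml.
    by case: (D w); rewrite ?mulr1 ?mulr0; lra.
  by apply/andP; split; [apply: mean_ge|apply: mean_le];
    rewrite ?size_cube_gt0// => w _; case/andP: (fb w).
have Gne n : exists g, G n g.
  by have [f Ff] := Fne n; exists (fun w => (f w - kappa) * true%:R), f, xpredT.
have [h [hup hlow]] := extremal_mean (ltn0Sn k) Gher GB Gne.
have [h0|h0] := lerP h 0.
  have [n0 nP] := hup _ kappa0; exists n0 => n nn g [f [D [Ff Di ->]]].
  have : mean (cube k.+1 n) (fun w => (f w - kappa) * (D w)%:R) <= h + kappa.
    by apply: nP => //; exists f, D.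
  have -> : mean (cube k.+1 n) (fun w => f w * (D w)%:R) =
      mean (cube k.+1 n) (fun w => (f w - kappa) * (D w)%:R) +
      kappa * mean (cube k.+1 n) (fun w => (D w)%:R).
    by rewrite -meanZ -meanD; apply: eq_mean => w _ /=; rewrite mulrBl subrK.
  have : mean (cube k.+1 n) (fun w => (D w)%:R) <= 1 :> R.
    by apply: mean_le => [|w _]; [exact: size_cube_gt0|exact: indic_le1].
  by move: kappa0; rewrite /kappa; nra.
have [q qP] := Fv _ (divr2_gt0 kappa0).
have [M MP] := insensitive_subspace q dhj ak (divr2_gt0 (divr2_gt0 h0)).
pose c := h / 2 / 2 / (size (subspaces k.+1 q M)).+1%:R.
have c0 : 0 < c by rewrite !divr_gt0.
(* small against the gain [c * kappa / 2] of discarding the common subspace *)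
pose e1 := Num.min (h / 2) (c * kappa / 8).
have e10 : 0 < e1 by rewrite lt_min !divr_gt0// mulr_gt0.
have e1h : e1 <= h / 2 by rewrite ge_min lexx.
have e1c : e1 <= c * kappa / 8 by rewrite ge_min lexx orbT.
have [n1 n1P] := hup _ e10; have [n2 n2P] := hlow M _ e10.
pose n := maxn n1 n2.
have [_ [f [D [Ff Di ->]]] gu] := n2P n (leq_maxr _ _).
have {}n1P := n1P n (leq_maxl _ _).
have Dbig : h / 2 <= mean (cube k.+1 n) (fun w =>
    mean (cube k.+1 M) (fun u => (D (u ++ w))%:R)).
  rewrite mean_exchange; apply: mean_ge => [|u uM]; first exact: size_cube_gt0.
  have : mean (cube k.+1 n) (fun w => (f (u ++ w) - kappa) * (D (u ++ w))%:R)
      <= mean (cube k.+1 n) (fun w => (D (u ++ w))%:R).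
    apply: ler_mean => w _; have := Fb _ _ (u ++ w) Ff; rewrite ler_norml.
    by case: (D _); rewrite /= ?mulr1 ?mulr0; lra.
  by have := gu u uM; lra.
have [|w _|w _ DW|s sM cW] := @mean_pigeonhole R _ _ _ (subspaces k.+1 q M) _ _
  (fun s w => all (fun t => D (embed s t ++ w)) (cube k.+1 q)) _ (divr2_gt0 h0) Dbig.
- exact: size_cube_gt0.
- by apply: mean_le => [|u _]; [exact: size_cube_gt0|exact: indic_le1].
- by apply: MP DW => u; have := insensitive_cat [::] w Di u.
(* the fibres that contain the subspace [s] *)
pose W w := all (fun t => D (embed s t ++ w)) (cube k.+1 q).
have Wi : insensitive k a W.
  move=> w; apply: eq_all => t.
  by have := insensitive_cat (embed s t) [::] Di w; rewrite !cats0.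
pose g w := (f w - kappa) * (D w)%:R.
(* On the slice over a point of the subspace, what remains of [D] outside [W]
   is insensitive, so that extremality bounds the average there. *)
have lower : {in cube k.+1 q, forall t, - (2 * e1) <=
    mean (cube k.+1 n) (fun w => g (embed s t ++ w) * (W w)%:R)}.
  move=> t tq; have uM := embed_cube sM tq; move: uM (gu _ uM).
  rewrite -/g; set u := embed s t => uM hu.
  have [f' [D' [Ff' Di' E]]] : exists f' D', [/\ F n f', insensitive k a D' &
    {in cube k.+1 n, forall w, g (u ++ w) * (~~ W w)%:R = (f' w - kappa) * (D' w)%:R}].
  - pose sl := slice u n [::].
    have /andP[/eqP su uK] := etrans (esym (mem_cube _ _ _)) uM.
    exists (fun w => f (embed sl w)), (fun w => D (embed sl w) && ~~ W w); split.
    + by apply: Fher Ff _; apply: slice_subspaces; rewrite ?su ?addn0.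
    + by move=> w; rewrite -Wi -(insensitive_embed sl k0 Di).
    + move=> w; rewrite mem_cube => /andP[/eqP sw _].
      by rewrite /g embed_slice// cats0 -mulrA -natrM mulnb.
  have := n1P _ (ex_intro _ f' (ex_intro _ D' (And3 Ff' Di' erefl))).
  rewrite -(eq_mean E).
  have -> : mean (cube k.+1 n) (fun w => g (u ++ w) * (W w)%:R) =
     mean (cube k.+1 n) (fun w => g (u ++ w)) -
     mean (cube k.+1 n) (fun w => g (u ++ w) * (~~ W w)%:R).
    rewrite -meanB; apply: eq_mean => w _ /=.
    by case: (W w); rewrite ?mulr1 ?mulr0 ?subr0 ?subrr.
  lra.
have := mean_ge (size_cube_gt0 q (ltn0Sn k)) lower.
rewrite mean_exchange.
have : mean (cube k.+1 n) (fun w => mean (cube k.+1 q) (fun t =>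
    g (embed s t ++ w) * (W w)%:R)) <=
    mean (cube k.+1 n) (fun w => (- (kappa / 2)) * (W w)%:R).
  apply: ler_mean => w wn; have [Ww|_] := boolP (W w); last first.
    rewrite mulr0 mean_le//; first exact: size_cube_gt0.
    by move=> t _; rewrite mulr0.
  have -> : mean (cube k.+1 q) (fun t => g (embed s t ++ w) * true%:R) =
      mean (cube k.+1 q) (fun t => f (embed s t ++ w)) - kappa.
    rewrite -[X in _ - X](mean_const kappa (size_cube_gt0 q (ltn0Sn k))) -meanB.
    by apply: eq_mean => t /(allP Ww) Dt; rewrite /g Dt !mulr1.
  pose sl := slice [::] M w.
  have slM : sl \in subspaces k.+1 M (M + n).
    by move: wn; rewrite mem_cube => /andP[/eqP sw wK]; apply: slice_subspaces; rewrite ?sw.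
  have := qP q (leqnn _) _ (Fher _ _ _ _ (Fher _ _ _ _ Ff slM) sM).
  have -> : mean (cube k.+1 q) (fun t => f (embed sl (embed s t))) =
      mean (cube k.+1 q) (fun t => f (embed s t ++ w)).
    apply: eq_mean => t /(embed_cube sM); rewrite mem_cube => /andP[/eqP st _].
    by rewrite embed_slice.
  by rewrite /= mulr1; lra.
rewrite meanZ; move: cW; rewrite -/c -/W; nra.
Qed.

Fixpoint cuts k F j := if j is i.+1 then cut k i (cuts k F i) else F.

Definition all_below j (C : nat -> pred (seq nat)) : pred (seq nat) :=
  fun w => all (fun a => C a w) (iota 0 j).

Lemma all_belowS j C w : all_below j.+1 C w = all_below j C w && C j w.
Proof. by rewrite /all_below -addn1 iotaD all_cat/= andbT. Qed.

Lemma cuts_all_below k F j C n f : F n f ->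
  (forall a, (a < j)%N -> insensitive k a (C a)) ->
  cuts k F j n (fun w => f w * (all_below j C w)%:R).
Proof.
move=> Ff; elim: j => [|j IHj] Ci /=.
  suff -> : (fun w => f w * (all_below 0 C w)%:R) = f by [].
  by apply/funext => w; rewrite mulr1.
exists (fun w => f w * (all_below j C w)%:R), (C j); split.
- by apply: IHj => a aj; apply: Ci; rewrite ltnS ltnW.
- exact: Ci.
- by apply/funext => w; rewrite all_belowS -mulrA -natrM mulnb.
Qed.

(** The complement of an intersection of insensitive sets is a disjoint union
    of intersections of insensitive sets: sort points by the first set that
    they miss. *)
Lemma complement_limsup_nonpos k F (e : R) : DHJ R k -> (0 < k)%N -> hereditary k.+1 F ->
  bounded_class F -> (forall n, exists f, F n f) -> limsup_nonpos k.+1 F -> 0 < e ->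
  exists n0, forall n, (n0 <= n)%N -> forall f (C : nat -> pred (seq nat)), F n f ->
    (forall a, (a < k)%N -> insensitive k a (C a)) ->
    mean (cube k.+1 n) (fun w => f w * (~~ all_below k C w)%:R) <= e.
Proof.
move=> dhj k0 Fher Fb Fne Fv e0.
have cutsP j : (j <= k)%N -> [/\ hereditary k.+1 (cuts k F j), bounded_class (cuts k F j),
    (forall n, exists f, cuts k F j n f) & limsup_nonpos k.+1 (cuts k F j)].
  elim: j => [//|j IHj] jk; have [h b ne v] := IHj (ltnW jk).
  by split; [exact: cut_hereditary|exact: cut_bounded|exact: cut_exists|exact: cut_limsup_nonpos].
suff below j : (j <= k)%N -> forall e', 0 < e' ->
    exists n0, forall n, (n0 <= n)%N -> forall f C, F n f ->
      (forall a, (a < j)%N -> insensitive k a (C a)) ->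
      mean (cube k.+1 n) (fun w => f w * (~~ all_below j C w)%:R) <= e'.
  exact: below.
elim: j => [|j IHj] jk {e0}e e0.
  exists 0%N => n _ f C _ _; apply: mean_le; first exact: size_cube_gt0.
  by move=> w _; rewrite mulr0 ltW.
have [n1 n1P] := IHj (ltnW jk) _ (divr2_gt0 e0).
have [_ _ _ v] := cutsP _ jk; have [n2 n2P] := v _ (divr2_gt0 e0).
exists (maxn n1 n2) => n; rewrite geq_max => /andP[nn1 nn2] f C Ff Ci.
have := n1P n nn1 f C Ff (fun a aj => Ci a (leq_trans aj (leqnSn j))).
have := n2P n nn2 (fun w => (f w * (all_below j C w)%:R) * (~~ C j w)%:R).
have -> : mean (cube k.+1 n) (fun w => f w * (~~ all_below j.+1 C w)%:R) =
  mean (cube k.+1 n) (fun w => f w * (~~ all_below j C w)%:R) +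
  mean (cube k.+1 n) (fun w => (f w * (all_below j C w)%:R) * (~~ C j w)%:R).
  rewrite -meanD; apply: eq_mean => w _ /=; rewrite all_belowS.
  by case: (all_below _ _ _); case: (C j w); rewrite /= ?mulr1 ?mulr0 ?addr0 ?add0r.
suff Fc : cuts k F j.+1 n (fun w => (f w * (all_below j C w)%:R) * (~~ C j w)%:R).
  by move=> /(_ Fc); lra.
exists (fun w => f w * (all_below j C w)%:R), (predC (C j)); split => //.
- by apply: cuts_all_below => // a aj; apply: Ci; rewrite ltnS ltnW.
- by move=> w; rewrite /= -Ci.
Qed.

End CutAverages.

(** * The density Hales-Jewett theorem *)

Section DensityHalesJewett.
Context (R : realType).

(** The letter [k] of [y] acts as a wildcard that receives [c].  The letter in
    front makes sure that this wildcard occurs at least once. *)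
Definition block k (y : seq nat) (c : nat) : seq nat := c :: map (flip k c) y.

Definition blocks k (ys : seq (seq nat)) (u : seq nat) : seq nat :=
  flatten [seq block k p.1 p.2 | p <- zip ys u].

(** Substituting the points of a line into blocks gives the points of a line
    again (see [plug_line_blocks]): a block that receives the wildcard becomes a
    pattern whose wildcards are its front position and its letters [k]. *)
Definition line_block k (y : seq nat) (l : option nat) : seq (option nat) :=
  if l is Some c then map Some (block k y c)
  else None :: map (fun x => if x == k then None else Some x) y.

Definition line_blocks k (ys : seq (seq nat)) (L : seq (option nat)) : seq (option nat) :=
  flatten [seq line_block k p.1 p.2 | p <- zip ys L].

Lemma plug_line_block k y l a : plug (line_block k y l) a = block k y (odflt a l).
Proof.
case: l => [c|]; first exact: plug_Some.
rewrite /plug /block /= -map_comp; congr (_ :: _); apply: eq_map => x /=.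
by rewrite /flip; case: ifP.
Qed.

Lemma plug_line_blocks k ys L a : plug (line_blocks k ys L) a = blocks k ys (plug L a).
Proof.
elim: ys L => [|y ys IHys] [|l L] //.
by rewrite /line_blocks /blocks/= plug_cat plug_line_block; congr (_ ++ _); exact: IHys.
Qed.

Lemma blocks_cat k ys1 y ys2 u1 c u2 : size ys1 = size u1 ->
  blocks k (ys1 ++ y :: ys2) (u1 ++ c :: u2) =
  blocks k ys1 u1 ++ block k y c ++ blocks k ys2 u2.
Proof. by move=> s; rewrite /blocks zip_cat// map_cat flatten_cat. Qed.

Lemma block_cube k m y c :
  y \in cube k.+1 m -> (c < k.+1)%N -> block k y c \in cube k.+1 m.+1.
Proof.
rewrite !mem_cube => /andP[/eqP <- yk] ck; rewrite /= size_map eqxx ck/= all_map.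
by apply: sub_all yk => x /= xk; rewrite /flip; case: ifP.
Qed.

Lemma blocks_cube k m n ys u : ys \in words (cube k.+1 m) n -> u \in cube k.+1 n ->
  blocks k ys u \in cube k.+1 (n * m.+1).
Proof.
rewrite mem_words !mem_cube => /andP[/eqP sy].
elim: n ys u sy => [|n IHn] [|y ys] [|c u]// [sy] /andP[ym ysm] /andP[/eqP[su] /andP[ck uk]].
have /andP[/eqP s1 a1] : (size (blocks k ys u) == n * m.+1)%N &&
    all (fun a => a < k.+1)%N (blocks k ys u).
  by apply: IHn => //; rewrite su eqxx.
have := block_cube ym ck; rewrite mem_cube => /andP[/eqP s2 a2].
rewrite -[blocks _ _ _]/(block k y c ++ blocks k ys u).
by rewrite size_cat all_cat s1 s2 a1 a2 mulSn eqxx.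
Qed.

Lemma line_blocks_lines k m n ys L : ys \in words (cube k.+1 m) n -> L \in lines k.+1 n ->
  line_blocks k ys L \in lines k.+1 (n * m.+1).
Proof.
rewrite mem_words !mem_lines => /andP[/eqP sy ym] /and3P[NL /eqP sL LK].
have -> : None \in line_blocks k ys L.
  move: NL; rewrite -sy in sL; elim: ys L sL {sy ym LK} => [|y ys IHys] [|l L]//= [sL].
  rewrite inE /line_blocks/= mem_cat => /orP[/eqP <-|NL]; first by rewrite mem_head.
  by rewrite IHys ?orbT.
rewrite andTb; elim: n ys L sy sL ym LK {NL} => [|n IHn] [|y ys] [|l L] // [sy] [sL].
move=> /andP[ym ysm] /andP[lK LK]; have /andP[/eqP s a] := IHn _ _ sy sL ysm LK.
rewrite -[line_blocks _ _ _]/(line_block k y l ++ line_blocks k ys L).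
rewrite size_cat all_cat s a andbT mulSn.
move: ym; rewrite inE mem_cube => /andP[/eqP sym yk].
case: l lK => [c|] cK/=; rewrite ?size_map sym eqxx/= ?cK/= !all_map.
  by apply: sub_all yk => x /= xk; rewrite /flip; case: ifP.
by apply: sub_all yk => x /= xk; case: ifP.
Qed.

Definition centred_line_free k K (h : R) n (g : seq nat -> R) : Prop :=
  exists2 f, line_free k K n f & g = fun w => f w - h.

Lemma centred_line_free_hereditary k K h : hereditary K (centred_line_free k K h).
Proof.
move=> n q g s [f Ff ->] sq; exists (fun t => f (embed s t)) => //.
exact: line_free_hereditary Ff sq.
Qed.

(** Let [A] be a nearly extremal line-free set over [K = k.+1] letters, with
    limiting density [h > 0].  For words of blocks [ys], the set of [u] with
    [blocks k ys u ++ w] in [A] has density almost [h] on average, so it often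
    contains a [k]-letter line, and one pattern [L] serves for a positive
    proportion [th] of all pairs [(ys, w)].

    Let only one block [y] that carries a wildcard of [L] vary.  The points of
    the line at a letter [a < k] lie in [A] for [y] in an [(k, a)]-insensitive
    set [C a]; the point at [k] is a point of a subspace.  As [A] has no line,
    it misses the intersection of the [C a] in that subspace, while on the
    complement of this intersection its density is at most about [h].  So its
    density in the subspace is about [h] times that of the complement, hence on
    average at most [h * (1 - th)], against the nearly full density [h]. *)
Lemma DHJ_succ k : (0 < k)%N -> DHJ R k -> DHJ R k.+1.
Proof.
move=> k0 dhj d d0; set K := k.+1; have K0 : (0 < K)%N by [].
have [h [hup hlow]] := extremal_mean K0 (@line_free_hereditary R K K)
  (fun n f => @line_free_bounded R K K n f K0) (fun n => @line_free_exists R K K n K0).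
have [h0|h0] := lerP h 0.
  have [n0 nP] := hup _ (divr2_gt0 d0); exists n0 => A dA.
  rewrite -[has _ _]negbK; apply/negP => Afree.
  by have := nP _ (leqnn _) _ (ex_intro2 _ _ A erefl Afree); lra.
exfalso.
have h1 : h <= 1.
  apply/ler_addgt0Pr => e e0; have [n nP] := hlow 0%N e e0.
  have [f Ff] := nP n (leqnn n); move=> /(_ [::] (mem_head _ _)).
  have := line_free_bounded K0 Ff; rewrite ler_norml add0n => /andP[_].
  rewrite [X in X <= _](@eq_mean _ _ _ _ (fun w => f ([::] ++ w)))//; lra.
pose F := centred_line_free K K h.
have Fher : hereditary K F by exact: centred_line_free_hereditary.
have Fb : bounded_class F.
  move=> n g w [_ [A -> _] ->]; rewrite ler_norml; case: (A w) => /=; lra.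
have Fne n : exists g, F n g.
  by have [f Ff] := @line_free_exists R K K n K0; exists (fun w => f w - h), f.
have Fv : limsup_nonpos K F.
  move=> e e0; have [n0 nP] := hup _ e0; exists n0 => n nn g [f Ff ->].
  by rewrite meanB mean_const ?size_cube_gt0//; have := nP n nn f Ff; lra.
have [n0 n0P] := DHJ_extend dhj (introT andP (conj k0 (leqnSn k))) (divr2_gt0 (divr2_gt0 h0)).
pose th := h / 2 / 2 / (size (lines K n0)).+1%:R.
have th0 : 0 < th by rewrite !divr_gt0.
have th1 : th <= 1.
  rewrite ler_pdivrMr// mul1r (@le_trans _ _ 1)//; first lra.
  by rewrite ler1n.
pose e := th * h / 4.
have e0 : 0 < e by rewrite divr_gt0// mulr_gt0.
have eh : e <= h / 2 by rewrite /e; nra.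
have [m mP] := complement_limsup_nonpos dhj k0 Fher Fb Fne Fv e0.
pose M := (n0 * m.+1)%N.
have [N NP] := hlow M _ e0; have [_ [A -> Afree] Ap] := NP N (leqnn N).
have {}mP := mP m (leqnn m).
pose Z := words (cube K m) n0.
have Z0 : (0 < size Z)%N by rewrite size_words_gt0 ?size_cube_gt0.
have N0 : (0 < size (cube K N))%N by exact: size_cube_gt0.
(* the line of [L] below the letter [k], in the fibre of a pair [p = (ys, w)] *)
pose G L (p : seq (seq nat) * seq nat) :=
  line_in k (fun u => A (blocks k p.1 u ++ p.2)) L.
have big : h / 2 <= mean [seq (ys, w) | ys <- Z, w <- cube K N] (fun p =>
    mean (cube K n0) (fun u => (A (blocks k p.1 u ++ p.2))%:R)).
  rewrite mean_allpairs; apply: mean_ge => // ys ysZ; rewrite mean_exchange.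
  apply: mean_ge => [|u un]; first exact: size_cube_gt0.
  by have := Ap _ (blocks_cube ysZ un); lra.
have [||p _ /n0P //|L LK thG] := @mean_pigeonhole R _ _ _ (lines K n0) _ _ G _
    (divr2_gt0 h0) big.
- by rewrite size_allpairs muln_gt0 Z0.
- by move=> p _; apply: mean_le => [|u _]; [exact: size_cube_gt0|exact: indic_le1].
have total_low : h - e <= mean Z (fun ys => mean (cube K N)
    (fun w => (A (blocks k ys (plug L k) ++ w))%:R)).
  by apply: mean_ge => // ys ysZ; apply: Ap; apply: blocks_cube => //; exact: plug_cube.
have [L1 [L2 EL]] : exists L1 L2, L = L1 ++ None :: L2.
  by move: LK; rewrite mem_lines => /and3P[/splitPr[L1 L2] _ _]; exists L1, L2.
have n0E : n0 = (size L1 + (size L2).+1)%N.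
  by move: LK; rewrite mem_lines EL size_cat => /and3P[_ /eqP <- _].
(* the upper bound, for all blocks but the varying one fixed *)
have fibre ys1 ys2 w : ys1 \in words (cube K m) (size L1) ->
  ys2 \in words (cube K m) (size L2) -> w \in cube K N ->
  mean (cube K m) (fun y => (A (blocks k (ys1 ++ y :: ys2) (plug L k) ++ w))%:R +
     h * (G L (ys1 ++ y :: ys2, w))%:R) <= h + e.
  move=> ys1Z ys2Z wN.
  have sy1 a : size ys1 = size (plug L1 a).
    by move: ys1Z; rewrite mem_words size_map => /andP[/eqP].
  have plugL a : plug L a = plug L1 a ++ a :: plug L2 a by rewrite EL plug_cat.
  pose v1 := blocks k ys1 (plug L1 k); pose v2 := blocks k ys2 (plug L2 k).
  pose C a y := A (blocks k ys1 (plug L1 a) ++ block k y a ++ blocks k ys2 (plug L2 a) ++ w).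
  have AE a y : A (blocks k (ys1 ++ y :: ys2) (plug L a) ++ w) = C a y.
    by rewrite plugL blocks_cat// -!catA.
  have GE y : G L (ys1 ++ y :: ys2, w) = all_below k C y.
    by apply: eq_all => a; exact: AE.
  have Ci a : (a < k)%N -> insensitive k a (C a).
    by move=> _ y; rewrite /C /block -map_comp (eq_map (flip_idem k a)).
  pose sl := slice (v1 ++ [:: k]) m (v2 ++ w).
  have slE y : y \in cube K m -> C k y = A (embed sl y).
    rewrite mem_cube => /andP[/eqP sy _]; rewrite embed_slice// -!catA /C /block/=.
    rewrite (_ : map (flip k k) y = y)//; apply: map_id_in => x _.
    by rewrite /flip; case: eqP.
  have slM : sl \in subspaces K m (M + N).
    have := plug_cube LK (ltnSn k); rewrite mem_cube plugL all_cat/=.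
    move=> /and3P[_ pk1 /andP[_ pk2]].
    have := blocks_cube ys1Z (_ : plug L1 k \in cube K _).
    have := blocks_cube ys2Z (_ : plug L2 k \in cube K _).
    rewrite !mem_cube !size_map !eqxx pk1 pk2 => /(_ isT)/andP[/eqP s2 a2].
    move=> /(_ isT)/andP[/eqP s1 a1]; move: wN; rewrite mem_cube => /andP[/eqP sw wK].
    apply: slice_subspaces; rewrite ?all_cat/= ?a1 ?a2 ?wK ?ltnSn//.
    by rewrite !size_cat s1 s2 sw /M n0E mulnDl mulSn -!addnA.
  have := mP (fun y => (A (embed sl y))%:R - h) C.
  have -> : mean (cube K m) (fun y => (A (blocks k (ys1 ++ y :: ys2) (plug L k) ++ w))%:R +
     h * (G L (ys1 ++ y :: ys2, w))%:R) =
    mean (cube K m) (fun y => ((A (embed sl y))%:R - h) * (~~ all_below k C y)%:R) + h.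
    rewrite -[X in _ + X](mean_const h (size_cube_gt0 m K0)) -meanD.
    apply: eq_mean => y ym /=; rewrite AE GE -slE//.
    have [Cy|_] := boolP (all_below k C y); last by rewrite /= mulr1 mulr0 addr0 subrK.
    suff /negbTE -> : ~~ C k y by rewrite /= mulr0 mulr1.
    apply: contra Afree => Cky; apply/hasP.
    have ysZ : ys1 ++ y :: ys2 \in words (cube K m) n0.
      move: ys1Z ys2Z; rewrite !mem_words n0E size_cat/= all_cat/= ym.
      by move=> /andP[/eqP -> ->] /andP[/eqP -> ->]; rewrite eqxx.
    exists (line_blocks k (ys1 ++ y :: ys2) L ++ map Some w).
      by apply: mem_lines_cat => //; exact: line_blocks_lines.
    apply/allP => a; rewrite mem_iota/= add0n ltnS plug_cat plug_Some plug_line_blocks AE.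
    rewrite leq_eqVlt => /orP[/eqP -> //|ak].
    by apply: (allP Cy); rewrite mem_iota.
  move=> H; rewrite addrC lerD2l; apply: H => //.
  exists (fun y => (A (embed sl y))%:R) => //.
  by apply: (line_free_hereditary (f := fun w => (A w)%:R)) slM; exists A.
have total_up : mean Z (fun ys => mean (cube K N) (fun w =>
    (A (blocks k ys (plug L k) ++ w))%:R + h * (G L (ys, w))%:R)) <= h + e.
  rewrite mean_exchange; apply: mean_le => // w wN.
  rewrite /Z n0E mean_words_middle.
  apply: mean_le => [|ys1 ys1Z]; first by rewrite size_words_gt0 ?size_cube_gt0.
  apply: mean_le => [|ys2 ys2Z]; first by rewrite size_words_gt0 ?size_cube_gt0.
  exact: fibre.
move: total_up thG; rewrite mean_allpairs -/th.
have -> : mean Z (fun ys => mean (cube K N) (fun w =>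
    (A (blocks k ys (plug L k) ++ w))%:R + h * (G L (ys, w))%:R)) =
  mean Z (fun ys => mean (cube K N) (fun w => (A (blocks k ys (plug L k) ++ w))%:R)) +
  h * mean Z (fun ys => mean (cube K N) (fun w => (G L (ys, w))%:R)).
  by rewrite -meanZ -meanD; apply: eq_mean => ys _; rewrite meanD meanZ.
move=> up thG.
have : h * th <= h * mean Z (fun ys => mean (cube K N) (fun w => (G L (ys, w))%:R)).
  by rewrite ler_pM2l.
have : 0 < h * th by rewrite mulr_gt0.
rewrite /e in up total_low *; lra.
Qed.

Theorem density_Hales_Jewett k : (0 < k)%N -> DHJ R k.
Proof.
case: k => // k _; elim: k => [|k IHk]; last exact: DHJ_succ.
move=> d d0; exists 1%N => A; rewrite /mean/= big_seq1 divr1 => dA.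
have A0 : A [:: 0%N] by move: dA; case: (A _) => //=; lra.
by rewrite /lines/= /line_in/= A0.
Qed.

End DensityHalesJewett.

(** * Multiple returns along dilations *)

Section Recurrence.
Context (R : realType) (d : measure_display) (X : measurableType d).
Context (mu : probability X R).

Lemma integral_simple (I : Type) (r : seq I) (c : I -> R) (S : I -> set X) :
  (forall i, 0 <= c i) -> (forall i, measurable (S i)) ->
  (\int[mu]_x (\sum_(i <- r) (c i * \1_(S i) x))%:E)%E =
  (\sum_(i <- r) c i * fine (mu (S i)))%:E.
Proof.
move=> c0 mS.
under eq_integral do rewrite -sumEFin.
rewrite ge0_integral_sum//.
- rewrite -sumEFin; apply: eq_bigr => i _.
  rewrite (integralZl_indic measurableT (fun=> S i))// => [|/lt_geF]; last by rewrite c0.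
  by rewrite integral_indic// setIT EFinM fineK// fin_num_measure.
- by move=> i; apply/measurable_EFinP; apply: measurable_funM.
- by move=> i x _; rewrite lee_fin mulr_ge0.
Qed.

Lemma ler_simple (I J : Type) (r : seq I) (s : seq J) (c : I -> R) (e : J -> R)
    (S : I -> set X) (U : J -> set X) :
  (forall i, 0 <= c i) -> (forall j, 0 <= e j) ->
  (forall i, measurable (S i)) -> (forall j, measurable (U j)) ->
  (forall x, \sum_(i <- r) c i * \1_(S i) x <= \sum_(j <- s) e j * \1_(U j) x) ->
  \sum_(i <- r) c i * fine (mu (S i)) <= \sum_(j <- s) e j * fine (mu (U j)).
Proof.
move=> c0 e0 mS mU le; rewrite -lee_fin -!integral_simple//.
apply: ge0_le_integral => //.
- by move=> x _; rewrite lee_fin; apply: sumr_ge0 => i _; rewrite mulr_ge0.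
- apply/measurable_EFinP; apply: measurable_sum => i; exact: measurable_funM.
- apply/measurable_EFinP; apply: measurable_sum => i; exact: measurable_funM.
- by move=> x _; rewrite lee_fin.
Qed.

Lemma sumn_plug (L : seq (option nat)) a :
  sumn (plug L a) = (sumn (plug L 0) + a * count_mem None L)%N.
Proof.
elim: L => [|[c|] L IHL] /=; first by rewrite muln0.
  by rewrite IHL add0n addnA.
by rewrite IHL add0n mulnDr muln1 addnCA.
Qed.

Context (T : int -> X -> X) (A : set X).
Context (TT : pp_Zaction mu T) (mA : measurable A).

Definition returns k n : set X := \bigcap_(i < k) (T (i * n)%N%:Z @^-1` A).

Lemma action_natD p q x : T (p + q)%N%:Z x = T p%:Z (T q%:Z x).
Proof. by have [_ TD _] := TT; rewrite PoszD TD. Qed.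

Lemma measurable_preT n (B : set X) : measurable B -> measurable (T n @^-1` B).
Proof.
move=> mB; have [_ _ /(_ n)[mT _]] := TT.
by rewrite -[X in measurable X]setTI; exact: mT.
Qed.

Lemma mu_preT n (B : set X) : measurable B -> mu (T n @^-1` B) = mu B.
Proof. by move=> mB; have [_ _ /(_ n)[_]] := TT; exact. Qed.

Lemma measurable_returns k n : measurable (returns k n).
Proof. by apply: bigcap_measurableType => // i _; exact: measurable_preT. Qed.

(** Reading a word [w] as the time [m * sumn w] turns a combinatorial line
    into an arithmetic progression whose step is [m] times the number [r] of
    wildcards, and [r <= n].  A point that is in [A] at a proportion at least
    [mu A / 2] of these times is in [A] along a whole line; integrating over
    the space, some line is followed on a set of measure bounded below
    independently of [m]. *)
Lemma returns_multiple k : (0 < k)%N -> (0 < mu A)%E ->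
  exists n c, [/\ (0 < n)%N, 0 < c & forall m,
    c <= \sum_(1 <= r < n.+1) fine (mu (returns k (r * m)))].
Proof.
move=> k0 A0.
pose a := fine (mu A).
have a0 : 0 < a by apply: fine_gt0; rewrite A0 ltey_eq fin_num_measure.
have [n nP] := @density_Hales_Jewett R k k0 _ (divr2_gt0 a0).
have Nn0 := size_cube_gt0 n k0; have NR : 0 < (size (cube k n))%:R :> R by rewrite ltr0n.
exists n, (a / 2 / (size (lines k n)).+1%:R).
have n0 : (0 < n)%N.
  case: n nP {Nn0 NR} => // /(_ predT); rewrite /lines/= => /(_ _)/wrap[]//.
  by rewrite /mean/= big_seq1 divr1 /a; have := probability_le1 mu mA;
    rewrite -[X in (X <= _)%E]fineK ?fin_num_measure// lee_fin -/a; move: a0; lra.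
split => //; first by rewrite !divr_gt0.
move=> m.
pose S w := T (m * sumn w)%N%:Z @^-1` A.
pose U L := \bigcap_(i < k) S (plug L i).
have mS w : measurable (S w) by exact: measurable_preT.
have mU L : measurable (U L) by apply: bigcap_measurableType => // i _.
have muS w : fine (mu (S w)) = a by rewrite /a /S mu_preT.
have muU L : L \in lines k n ->
    fine (mu (U L)) <= \sum_(1 <= r < n.+1) fine (mu (returns k (r * m))).
  rewrite mem_lines => /and3P[NL /eqP sL _].
  pose r := count_mem None L.
  have -> : U L = T (m * sumn (plug L 0))%N%:Z @^-1` returns k (r * m).
    have tE i : (m * sumn (plug L i) = i * (r * m) + m * sumn (plug L 0))%N.
      by rewrite sumn_plug mulnDr addnC (mulnC r m) mulnCA.
    by rewrite predeqE => x; split=> Ux i ik; have := Ux i ik; rewrite /S /= (tE i) action_natD.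
  rewrite mu_preT; last exact: measurable_returns.
  rewrite (bigD1_seq r) ?iota_uniq//=; last first.
    by rewrite mem_index_iota -has_count has_pred1 NL ltnS -sL count_size.
  by rewrite lerDl; apply: sumr_ge0 => i _; exact: fine_ge0.
pose N := (size (cube k n))%:R : R.
have total : N * a <= N * (a / 2) + N * \sum_(L <- lines k n) fine (mu (U L)).
  (* the constant [a / 2] is a multiple of the indicator of the whole space,
     here with the label [None] *)
  pose e (o : option (seq (option nat))) := N * (if o is Some _ then 1 else a / 2) : R.
  pose U' o := if o is Some L then U L else setT.
  have e0 o : 0 <= e o.
    by rewrite /e; case: o => [_|]; rewrite mulr_ge0// ltW// divr2_gt0.
  have mU' o : measurable (U' o) by case: o => [L|]; [exact: mU|exact: measurableT].
  have := @ler_simple _ _ (cube k n) (None :: map Some (lines k n)) (fun=> 1) e S U'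
    (fun=> ler01) e0 mS mU'.
  rewrite !big_cons !big_map /e /U' probability_setT [fine _]/= mulr1.
  have -> : \sum_(w <- cube k n) 1 * fine (mu (S w)) = N * a.
    under eq_bigr do rewrite mul1r muS.
    by rewrite big_const_seq count_predT iter_addr_0 -[_ *+ _]mulr_natl.
  rewrite mulr1 -big_distrr/=; apply => x.
  rewrite big_cons big_map indicT mulr1 -!big_distrr/= mul1r mulr1 -mulrDr.
  have -> : \sum_(w <- cube k n) \1_(S w) x = N * mean (cube k n) (fun w => (`[< S w x >])%:R) :> R.
    by rewrite /mean mulrC divfK ?gt_eqF//; apply: eq_bigr.
  rewrite ler_pM2l//; set s := \sum_(L <- _) _.
  have s0 : 0 <= s by apply: sumr_ge0.
  have [/nP/hasP[L LL SL]|lt] := lerP (a / 2) (mean (cube k n) (fun w => (`[< S w x >])%:R)).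
    have le1 : mean (cube k n) (fun w => (`[< S w x >])%:R) <= 1 :> R.
      by apply: mean_le => // w _; exact: indic_le1.
    suff : 1 <= s by move: a0; lra.
    rewrite /s (perm_big _ (perm_to_rem LL))/= big_cons indicE mem_set/=; last first.
      by move=> i /= ik; apply/asboolP; apply: (allP SL); rewrite mem_iota.
    by rewrite lerDl; apply: sumr_ge0.
  by move: lt; lra.
have {}total : a / 2 <= \sum_(L <- lines k n) fine (mu (U L)).
  by move: total; rewrite -mulrDr ler_pM2l//; lra.
rewrite ler_pdivrMr ?ltr0n//; apply: (le_trans total).
set b := \sum_(_ <= _ < _) _ in muU *.
have b0 : 0 <= b by apply: sumr_ge0 => r _; exact: fine_ge0.
rewrite -addn1 natrD mulrDr mulr1 (@le_trans _ _ (b * (size (lines k n))%:R)) ?lerDl//.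
rewrite mulr_natr -[size _]count_predT -iter_addr_0 -big_const_seq.
by rewrite big_seq [leRHS]big_seq; apply: ler_sum => L; exact: muU.
Qed.

End Recurrence.

(** A sum over [r * m] for fixed [r > 0] is a sum over distinct indices; so the
    [n] sums obtained for [r = 1, ..., n] are all bounded by the full one. *)
Lemma sum_multiples (R : realType) (b : nat -> R) (c : R) n N :
  (forall i, 0 <= b i) -> (forall m, c <= \sum_(1 <= r < n.+1) b (r * m)%N) ->
  (N %/ n)%:R * c <= n%:R * \sum_(1 <= j < N.+1) b j.
Proof.
move=> b0 cb.
have sub r : r \in index_iota 1 n.+1 ->
    \sum_(1 <= m < (N %/ n).+1) b (r * m)%N <= \sum_(1 <= j < N.+1) b j.
  rewrite mem_index_iota ltnS => /andP[r0 rn].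
  rewrite -(big_map (fun m => r * m)%N predT).
  set s := map _ _; rewrite [leRHS](bigID (mem s))/= ler_wpDr ?sumr_ge0//.
  rewrite -[leRHS]big_filter (perm_big [seq j <- index_iota 1 N.+1 | j \in s])//.
  apply: uniq_perm.
  - rewrite map_inj_in_uniq ?iota_uniq// => x y _ _ /eqP.
    by rewrite eqn_pmul2l// => /eqP.
  - by rewrite filter_uniq ?iota_uniq.
  - move=> j; rewrite mem_filter; case: (boolP (j \in s)) => //= /mapP[m].
    rewrite !mem_index_iota !ltnS => /andP[m0 mN] ->; apply/esym; rewrite muln_gt0 r0 m0/=.
    by rewrite (leq_trans (leq_mul rn mN))// mulnC leq_trunc_div.
have : (N %/ n)%:R * c <= \sum_(1 <= m < (N %/ n).+1) \sum_(1 <= r < n.+1) b (r * m)%N.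
  rewrite mulr_natl -[X in c *+ X]subn0 -subSS -sumr_const_nat.
  by apply: ler_sum.
move=> /le_trans; apply; rewrite exchange_big/=.
rewrite mulr_natl -[X in _ *+ X]subn0 -subSS -sumr_const_nat.
by rewrite big_seq [leRHS]big_seq; apply: ler_sum.
Qed.

(** * Positivity of the lower limit *)

Lemma limn_einf_gt0 (R : realType) (u : (\bar R)^nat) (c : R) n0 :
  0 < c -> (forall n, (n0 <= n)%N -> (c%:E <= u n)%E) -> (0 < limn_einf u)%E.
Proof.
move=> c0 cu; apply: (@lt_le_trans _ _ c%:E); first by rewrite lte_fin.
rewrite limn_einf_lim; apply: lime_ge; first exact: is_cvg_einfs.
exists n0 => // n /= nn; apply: le_ereal_inf_tmp => _ [m /= nm <-].
by apply: cu; exact: leq_trans nm.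
Qed.

Local Open Scope ereal_scope.

Theorem theorem1p2 (R : realType) (d : measure_display) (X : measurableType d)
    (mu : probability X R) (T : int -> X -> X) (A : set X) :
  standard_borel R X -> pp_Zaction mu T ->
  measurable A -> 0 < mu A ->
  forall k : nat, (1 <= k)%N ->
  0 < limn_einf (fun N : nat =>
        (N%:R^-1)%:E *
        \sum_(1 <= n < N.+1) mu (\bigcap_(i < k) (T (i * n)%N%:Z @^-1` A))).
Proof.
move=> _ TT mA A0 k k0.
have [n [c [n0 c0 cP]]] := returns_multiple TT mA k0 A0.
pose b j := fine (mu (returns T A k j)).
have nR : (0 < n%:R :> R)%R by rewrite ltr0n.
apply: (@limn_einf_gt0 _ _ (c / (2 * n%:R * n%:R))%R n).
  by rewrite divr_gt0// !mulr_gt0.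
move=> N nN.
have NR : (0 < N%:R :> R)%R by rewrite ltr0n (leq_trans n0).
rewrite (eq_bigr (fun j => (b j)%:E)) => [|j _]; last first.
  by rewrite /b fineK// fin_num_measure//; exact: (measurable_returns TT).
rewrite sumEFin -EFinM lee_fin [leRHS]mulrC ler_pdivlMr//.
have := @sum_multiples R b c n N (fun j => fine_ge0 (measure_ge0 _ _)) cP.
set s := (\sum_(1 <= j < N.+1) b j)%R.
set q := (N %/ n)%:R%R.
have Nq : (N%:R <= 2 * n%:R * q :> R)%R.
  (* the quotient is positive, so [N < (q + 1) n <= 2 q n] *)
  rewrite /q -!natrM ler_nat; have q1 : (0 < N %/ n)%N by rewrite divn_gt0.
  have := ltn_ceil N n0; nia.
have s0 : (0 <= s)%R by apply: sumr_ge0 => j _; exact: fine_ge0.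
move=> qc; rewrite mulrAC ler_pdivrMr ?mulr_gt0//.
have : (c * N%:R <= c * (2 * n%:R * q))%R by rewrite ler_pM2l.
have : (2 * n%:R * (q * c) <= 2 * n%:R * (n%:R * s))%R by rewrite ler_pM2l// mulr_gt0.
lra.
Qed.
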